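(* Let $\nu>0$ and consider on the real line $x\in\mathbb{R}$ the equation $\omega_t=\omega\,\mathcal{H}(\omega)-\nu\Lambda\omega$. Let $\omega_{-1}(0),v_c(0)\in\mathbb{C}$ with $\mathrm{Re}[v_c(0)]>0$, and set $$\omega_{-1}(t)=\omega_{-1}(0),\qquad v_c(t)=(\omega_{-1}(0)+\nu)t+v_c(0),\qquad \omega(x,t)=\frac{\omega_{-1}(t)}{x-iv_c(t)}+\frac{\overline{\omega_{-1}(t)}}{x+i\,\overline{v_c(t)}} .$$ Then $\omega$ is an exact real-valued solution as long as $\mathrm{Re}[v_c(t)]>0$, with $$\|\omega(\cdot,t)\|_{L^\infty}=\frac{|\omega_{-1}(t)|+|\mathrm{Im}[\omega_{-1}(t)]|}{\mathrm{Re}[v_c(t)]},\qquad \|\omega(\cdot,t)\|_{L^2}=\sqrt{2\pi}\,\frac{|\omega_{-1}(t)|}{\sqrt{\mathrm{Re}[v_c(t)]}},$$ and: (a) if $\omega_{-1}(0)=-\nu$, the solution is time-independent; (b) if $\mathrm{Re}[\omega_{-1}(0)]>-\nu$, the solution exists for all $t>0$; (c) if $\mathrm{Re}[\omega_{-1}(0)]<-\nu$, the solution exists until $$t_c=-\frac{\mathrm{Re}[v_c(0)]}{\mathrm{Re}[\omega_{-1}(0)]+\nu}>0,$$ at which time the poles reach the real axis at $$x_c=\frac{\mathrm{Im}[\omega_{-1}(0)]\,\mathrm{Re}[v_c(0)]}{\mathrm{Re}[\omega_{-1}(0)]+\nu}-\mathrm{Im}[v_c(0)],$$ and for $0\le t<t_c$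 the solution has the self-similar form $$\omega(x,t)=\frac{i}{t_c-t}\left(\frac{\xi_++i\nu}{\xi-\xi_+}-\frac{\xi_--i\nu}{\xi-\xi_-}\right),\qquad \xi=\frac{x-x_c}{t_c-t},\qquad \xi_+=\frac{iv_c(0)-x_c}{t_c},\quad \xi_-=\frac{-i\,\overline{v_c(0)}-x_c}{t_c}.$$ In particular, in case (c) both $\|\omega(\cdot,0)\|_{L^\infty}$ and $\|\omega(\cdot,0)\|_{L^2}$ can be made arbitrarily small by choosing $\mathrm{Re}[v_c(0)]$ large enough, so finite-time singularities form from arbitrarily small data.
   Context: On the real line $\mathcal{H}f(x)=\frac1\pi\,\mathrm{PV}\int_{-\infty}^\infty\frac{f(x')}{x-x'}\,dx'$ (Fourier symbol $-i\,\mathrm{sgn}(k)$), and $\Lambda=\mathcal{H}\partial_x$ (symbol $|k|$). This is the generalized Constantin–Lax–Majda equation $\omega_t=-au\omega_x+\omega\mathcal{H}(\omega)-\nu\Lambda^\sigma\omega$ with $a=0$, $\sigma=1$. *)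

(* Defs.v *)
From HB Require Import structures.
From mathcomp Require Import all_boot all_order all_algebra.
From mathcomp Require Import complex.
From mathcomp Require Import all_classical all_reals all_analysis.
Set Implicit Arguments.
Unset Strict Implicit.
Unset Printing Implicit Defensive.
Import Order.TTheory GRing.Theory Num.Theory.
Import numFieldNormedType.Exports.
Local Open Scope classical_set_scope.
Local Open Scope ring_scope.
Local Open Scope complex_scope.

(* Truncation of the principal value: only the singularity at [y = x] is cut
   off symmetrically; at infinity the integral is absolutely convergent. *)
Definition hilbert_trunc {R : realType} (f : R -> R) (x e : R) : R :=
  \int[lebesgue_measure]_(y in [set y | e < `|x - y|]) (f y / (x - y)).

(* The principal value defining [hilbert f x] exists. This is needed because
   [Rintegral] and [lim] return junk values when they are undefined. *)
Definition hilbert_ex {R : realType} (f : R -> R) (x : R) : Prop :=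
  (forall e : R, 0 < e ->
     lebesgue_measure.-integrable [set y | e < `|x - y|]
       (fun y => (f y / (x - y))%:E)) /\
  cvg (hilbert_trunc f x e @[e --> 0^'+]).

Definition hilbert {R : realType} (f : R -> R) (x : R) : R :=
  pi^-1 * lim (hilbert_trunc f x e @[e --> 0^'+]).

Definition Lambda {R : realType} (f : R -> R) : R -> R := hilbert (derive1 f).

(* Classical (pointwise) solutions of w_t = w H(w) - nu Lambda w at the times
   in [T]; the time derivative is two-sided at every [t] in [T]. The space
   variable is the first argument of [w]. *)
Definition is_solution {R : realType} (nu : R) (T : set R) (w : R -> R -> R)
  : Prop :=
  forall t x : R, T t ->
    [/\ derivable (fun s => w x s) t 1,
        derivable (fun y => w y t) x 1,
        hilbert_ex (fun y => w y t) x,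
        hilbert_ex (derive1 (fun y => w y t)) x &
        derive1 (fun s => w x s) t =
          w x t * hilbert (fun y => w y t) x
          - nu * Lambda (fun y => w y t) x].

Definition Linfty_norm {R : realType} (f : R -> R) : \bar R :=
  Lnorm lebesgue_measure +oo%E (EFin \o f).

Definition L2_norm {R : realType} (f : R -> R) : \bar R :=
  Lnorm lebesgue_measure 2%:E (EFin \o f).

(* [w] solves the equation on [0, tc) and becomes unbounded as t -> tc. *)
Definition singular_at {R : realType} (nu : R) (w : R -> R -> R) (tc : R)
  : Prop :=
  [/\ 0 < tc,
      is_solution nu [set t | 0 <= t < tc] w &
      Linfty_norm (fun x => w x t) @[t --> tc^'-] --> +oo%E].

(* [w0] and [v0] are the initial residue parameter omega_{-1}(0) and the
   initial pole parameter v_c(0); omega_{-1}(t) is constantly [w0]. *)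
Definition vc {R : realType} (nu : R) (w0 v0 : R[i]) (t : R) : R[i] :=
  (w0 + nu%:C) * t%:C + v0.

Definition omegaC {R : realType} (nu : R) (w0 v0 : R[i]) (x t : R) : R[i] :=
  w0 / (x%:C - 'i%C * vc nu w0 v0 t)
  + w0^*%C / (x%:C + 'i%C * (vc nu w0 v0 t)^*%C).

Definition omega {R : realType} (nu : R) (w0 v0 : R[i]) (x t : R) : R :=
  complex.Re (omegaC nu w0 v0 x t).

(* Main.v *)
Require Import Defs.
From HB Require Import structures.
From mathcomp Require Import all_boot all_order all_algebra.
From mathcomp Require Import complex.
From mathcomp Require Import all_classical all_reals all_analysis.
From mathcomp Require Import measurable_realfun ess_sup_inf ring lra.
Set Implicit Arguments.
Unset Strict Implicit.
Unset Printing Implicit Defensive.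
Import Order.TTheory GRing.Theory Num.Theory.
Import numFieldNormedType.Exports.
Local Open Scope classical_set_scope.
Local Open Scope ring_scope.
Local Open Scope complex_scope.

(** With v = p + i q and s = x + q, taking real parts gives
      w (x, t) = 2 (Re w0 * s - Im w0 * p) / (s^2 + p^2),
    so at each time the solution is a Lorentzian [lorentz a b q p], a linear
    function of s over s^2 + p^2 (lemma [omegaC_lorentz]).  This family is
    stable under the Hilbert transform: [hilbert_lorentz] says that it acts as
    (a, b) |-> (b / p, - a p), which is multiplication of the residue w0 by i,
    and [hilbert_derive1_lorentz] that it commutes with the space derivative.
    The equation is thereby an identity of rational functions; it reduces to
    v' = w0 + nu, which is how v was chosen.

    The principal value is computed with an explicit primitive G of
    f y / (x - y), a logarithm plus an arctangent.  The integral over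
    e < |x - y| is G(+oo) - G(-oo) + (G(x - e) - G(x + e)); the logarithmic
    singularity of G at x is even, so the last bracket tends to 0
    ([hilbert_antiderivative]).  For the derivative no new integral arises:
    if E y = (f y - f x) / (x - y), then E is again a Lorentzian and
    f' y / (x - y) = E' y - E y / (x - y).

    The supremum is a maximum, attained where a quadratic form in s and p
    degenerates ([lorentz_Linfty]), and the L2 norm is one more integral with
    a rational-plus-arctangent primitive ([lorentz_L2]).  Everything about the
    blow-up follows from Re v being affine in t: it vanishes at tc, where the
    sup norm C / Re v tends to infinity, and both norms at time 0 are small
    when Re v0 is large. *)

(** * The fundamental theorem of calculus away from a point *)

Section half_line.
Context {R : realType}.
Notation mu := lebesgue_measure.
Implicit Types f F h H : R -> R.

Lemma ge0_FTC2y f F (a l : R) :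
  (forall y, a <= y -> 0 <= f y) ->
  (forall y, a <= y -> {for y, continuous f}) ->
  (forall y, a <= y -> is_derive y 1 F (f y)) ->
  F y @[y --> +oo] --> l ->
  (\int[mu]_(y in `[a, +oo[) (f y)%:E = (l - F a)%:E)%E.
Proof.
move=> f0 cf dF Fl; rewrite EFinB; apply: ge0_continuous_FTC2y => //.
- apply/continuous_within_itvcyP; split.
    by move=> y; rewrite in_itv/= andbT => /ltW; exact: cf.
  exact/cvg_at_right_filter/cf.
- by move=> y /ltW /dF; case.
- apply/cvg_at_right_filter/differentiable_continuous/derivable1_diffP.
  by have [] := dF a (lexx a).
- move=> y; rewrite in_itv/= andbT => /ltW /dF dFy.
  by rewrite derive1E derive_val.
Qed.

(** The substitution y |-> - y reduces this to [ge0_FTC2y]. *)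
Lemma ge0_FTC2Ny f F (a l : R) :
  (forall y, y <= a -> 0 <= f y) ->
  (forall y, y <= a -> {for y, continuous f}) ->
  (forall y, y <= a -> is_derive y 1 F (f y)) ->
  F y @[y --> -oo] --> l ->
  (\int[mu]_(y in `]-oo, a]) (f y)%:E = (F a - l)%:E)%E.
Proof.
move=> f0 cf dF Fl.
have cN (y : R) : - a <= y -> {for y, continuous (f \o -%R)}.
  move=> ay; apply: continuous_comp; first exact: opp_continuous.
  by apply: cf; rewrite lerNl.
rewrite -[in LHS](opprK a) ge0_integration_by_substitutionNy.
- transitivity ((- l - (- F (- - a)))%:E); last by rewrite !opprK addrC.
  apply: (@ge0_FTC2y (f \o -%R) (fun y => - F (- y))).
  + by move=> y ay; apply: f0; rewrite lerNl.
  + exact: cN.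
  + move=> y ay; have dFN : is_derive (- y) 1 F (f (- y)).
      by apply: dF; rewrite lerNl.
    have -> : (fun z => - F (- z)) = - (F \o -%R) by [].
    have dN := is_derive1_comp dFN (is_deriveNid y 1).
    by apply: is_derive_eq; rewrite mulrN1 opprK.
  + by apply: cvgN; have /cvgNy_compNP := Fl; exact.
- apply/continuous_within_itvNycP; split.
    by move=> y; rewrite opprK in_itv/= => /ltW; exact: cf.
  by apply/cvg_at_left_filter; rewrite opprK; exact/cf.
- by move=> y; rewrite opprK in_itv/= => /ltW; exact: f0.
Qed.

(** Adding a dominating [h] makes [f] nonnegative, which reduces the integral
    of a function of variable sign to two integrals of nonnegative ones. *)
Lemma dominated_integral (D : set R) f h (A B : R) : measurable D ->
  measurable_fun D f -> measurable_fun D h ->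
  (forall y, D y -> `|f y| <= h y) ->
  (\int[mu]_(y in D) (f y + h y)%:E = A%:E)%E ->
  (\int[mu]_(y in D) (h y)%:E = B%:E)%E ->
  mu.-integrable D (EFin \o f) /\ \int[mu]_(y in D) f y = A - B.
Proof.
move=> mD mf mh fh fhA hB.
have h0 y : D y -> 0 <= h y by move=> /fh; exact: le_trans.
have ih : mu.-integrable D (EFin \o h).
  apply/integrableP; split; first exact/measurable_EFinP.
  rewrite (_ : integral _ _ _ = B%:E) ?ltry// -hB.
  by apply: eq_integral => y /[!inE] Dy /=; rewrite ger0_norm// h0.
have if_ : mu.-integrable D (EFin \o f).
  apply: le_integrable ih => //; first exact/measurable_EFinP.
  move=> y Dy /=; rewrite lee_fin (ger0_norm (h0 _ Dy)); exact: fh.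
split=> //; have := @RintegralD _ _ _ mu D f h mD if_ ih.
rewrite {1}/Rintegral fhA {2}/Rintegral hB /= => ->; by rewrite addrK.
Qed.

Lemma open_subset_measurable_fun (D E : set R) f : open D -> E `<=` D ->
  measurable E -> (forall y, D y -> {for y, continuous f}) ->
  measurable_fun E f.
Proof.
move=> oD ED mE cf; apply: (measurable_funS (open_measurable oD) ED).
apply: open_continuous_measurable_fun => // y /[!inE] Dy; exact: cf.
Qed.

Lemma outer_setE (x e : R) :
  [set y | e < `|x - y|] = `]-oo, x - e[%classic `|` `]x + e, +oo[%classic.
Proof.
apply/seteqP; split=> y /=; rewrite !in_itv/= ?andbT ltr_normr.
  by move=> /orP[] ?; [left|right]; lra.
by move=> [] ?; apply/orP; [left|right]; lra.
Qed.

Lemma measurable_outer (x e : R) : measurable [set y | e < `|x - y|].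
Proof. by rewrite outer_setE; exact: measurableU. Qed.

Section outer.
Variables (x e : R).
Hypothesis e0 : 0 < e.

Lemma outer_le y : y <= x - e -> e <= `|x - y|.
Proof. by move=> ?; rewrite ler_normr; apply/orP; left; lra. Qed.

Lemma outer_ge y : x + e <= y -> e <= `|x - y|.
Proof. by move=> ?; rewrite ler_normr; apply/orP; right; lra. Qed.

Lemma outer_measurable_fun f :
  (forall y, e <= `|x - y| -> {for y, continuous f}) ->
  measurable_fun [set y | e < `|x - y|] f.
Proof.
move=> cf; apply: (@open_subset_measurable_fun [set y | e < `|x - y|]) => //.
- by rewrite outer_setE; apply: openU; exact: interval_open.
- exact: measurable_outer.
- by move=> y /ltW; exact: cf.
Qed.

Lemma ge0_FTC2_outer f F (l m : R) :
  (forall y, e <= `|x - y| -> 0 <= f y) ->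
  (forall y, e <= `|x - y| -> {for y, continuous f}) ->
  (forall y, e <= `|x - y| -> is_derive y 1 F (f y)) ->
  F y @[y --> -oo] --> l -> F y @[y --> +oo] --> m ->
  (\int[mu]_(y in [set y | (e < `|x - y|)%R]) (f y)%:E =
    (m - l + (F (x - e) - F (x + e)))%:E)%E.
Proof.
move=> f0 cf dF Fl Fm; have mf := outer_measurable_fun cf.
rewrite outer_setE in mf *.
rewrite ge0_integral_setU //=; last 3 first.
- exact/measurable_EFinP.
- move=> y; rewrite lee_fin !in_itv/= andbT => -[|] /ltW yx; apply: f0;
    [exact: outer_le|exact: outer_ge].
- apply/disj_setPS => y [] /=; rewrite !in_itv/= andbT => yl yr.
  by move: (lt_trans yr yl) e0; lra.
rewrite integral_itv_bndo_bndc; last first.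
  by apply/measurable_EFinP; apply: measurable_funS mf => //; exact: measurableU.
rewrite integral_itv_obnd_cbnd; last first.
  by apply/measurable_EFinP; apply: measurable_funS mf => //; exact: measurableU.
rewrite (_ : (m - l + _)%:E = (F (x - e) - l)%:E + (m - F (x + e))%:E)%E;
  last by rewrite -EFinD; congr EFin; ring.
congr (_ + _)%E.
- by apply: ge0_FTC2Ny Fl => y /outer_le; [exact: f0|exact: cf|exact: dF].
- by apply: ge0_FTC2y Fm => y /outer_ge; [exact: f0|exact: cf|exact: dF].
Qed.

(** The two half-lines are treated together so that integrability is obtained
    directly on the truncated domain of the principal value. *)
Lemma dominated_FTC2_outer f F h H (l m l' m' : R) :
  (forall y, e <= `|x - y| -> `|f y| <= h y) ->
  (forall y, e <= `|x - y| -> {for y, continuous f}) ->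
  (forall y, e <= `|x - y| -> {for y, continuous h}) ->
  (forall y, e <= `|x - y| -> is_derive y 1 F (f y)) ->
  (forall y, e <= `|x - y| -> is_derive y 1 H (h y)) ->
  F y @[y --> -oo] --> l -> F y @[y --> +oo] --> m ->
  H y @[y --> -oo] --> l' -> H y @[y --> +oo] --> m' ->
  mu.-integrable [set y | e < `|x - y|] (EFin \o f) /\
  \int[mu]_(y in [set y | e < `|x - y|]) f y =
    m - l + (F (x - e) - F (x + e)).
Proof.
move=> fh cf ch dF dH Fl Fm Hl' Hm'.
rewrite (_ : m - l + (F (x - e) - F (x + e)) =
  (m + m') - (l + l') + ((F + H) (x - e) - (F + H) (x + e)) -
  (m' - l' + (H (x - e) - H (x + e)))); last by rewrite !fctE; ring.
apply: (@dominated_integral _ _ h).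
- exact: measurable_outer.
- exact: outer_measurable_fun.
- exact: outer_measurable_fun.
- by move=> y /ltW; exact: fh.
- apply: (@ge0_FTC2_outer (f + h) (F + H)).
  + by move=> y /fh; rewrite /= ler_norml => /andP[+ _]; rewrite -subr_ge0 opprK.
  + by move=> y ye; apply: continuousD; [exact: cf|exact: ch].
  + by move=> y ye; apply: is_deriveD; [exact: dF|exact: dH].
  + exact: cvgD.
  + exact: cvgD.
- by apply: ge0_FTC2_outer => // y /fh; exact: le_trans.
Qed.

End outer.
End half_line.

(** * Limits at infinity and derivatives of real functions *)

Section limits_at_infinity.
Context {R : realType}.
Implicit Types (f g : R -> R).

Lemma cvg_invr_pinfty : (y : R)^-1 @[y --> +oo] --> (0 : R).
Proof.
have /gtr0_cvgV0 : \forall y \near +oo, 0 < (id : R -> R) y.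
  exact: nbhs_pinfty_gt.
by move=> [_]; apply; exact: cvg_id.
Qed.

Lemma cvg_invr_ninfty : (y : R)^-1 @[y --> -oo] --> (0 : R).
Proof.
have /ltr0_cvgV0 : \forall y \near -oo, (id : R -> R) y < 0.
  exact: nbhs_ninfty_lt.
by move=> [_]; apply; exact: cvg_id.
Qed.

(** Limits of rational functions at both infinities: extend them
    continuously in the variable 1/y. *)
Lemma cvg_infty_inv g f : {for 0, continuous f} ->
  (forall y, y != 0 -> g y = f y^-1) ->
  g y @[y --> +oo] --> f 0 /\ g y @[y --> -oo] --> f 0.
Proof.
move=> cf gf; split.
- apply: (@cvg_trans _ (f y^-1 @[y --> +oo])).
    apply: near_eq_cvg; near=> y; rewrite gf//.
    by rewrite gt_eqF//; near: y; exact: nbhs_pinfty_gt.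
  exact: cvg_comp cvg_invr_pinfty cf.
- apply: (@cvg_trans _ (f y^-1 @[y --> -oo])).
    apply: near_eq_cvg; near=> y; rewrite gf//.
    by rewrite lt_eqF//; near: y; exact: nbhs_ninfty_lt.
  exact: cvg_comp cvg_invr_ninfty cf.
Unshelve. all: by end_near. Qed.

Lemma cvg_atan_affine (q p : R) : 0 < p ->
  atan ((y + q) / p) @[y --> +oo] --> pi / 2 /\
  atan ((y + q) / p) @[y --> -oo] --> - (pi / 2).
Proof.
move=> p0.
have cvgy r : atan ((y + r) / p) @[y --> +oo] --> pi / 2.
  apply: (cvg_comp (fun y => (y + r) / p) atan) (@cvgy_atan R).
  have i0 : 0 < p^-1 by rewrite invr_gt0.
  apply: (gt0_cvgMly i0); exact: cvg_addrr.
split; first exact: cvgy.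
apply/cvgNy_compNP.
have -> : (fun y => atan ((y + q) / p)) \o -%R = fun y => - atan ((y - q) / p).
  by apply/funext => y /=; rewrite -atanN -mulNr opprB addrC.
by apply: cvgN; exact: cvgy.
Qed.

End limits_at_infinity.

Lemma continuous_inv_at (R : realType) (f : R -> R) (x : R) : f x != 0 ->
  {for x, continuous f} -> {for x, continuous (fun y => (f y)^-1)}.
Proof. by move=> fx0 cf; apply: cvgV. Qed.

(** With functions written pointwise and ring multiplication in place of
    scaling, the derivative of an explicit expression is assembled by nesting
    these rules, and compared to its closed form by [field]. *)
Section scalar_derivatives.
Context {R : realType}.
Implicit Types (f g : R -> R) (x a b : R).

Lemma is_derive_const (k x : R) : is_derive x 1 (fun=> k) 0.
Proof. exact: is_derive_cst. Qed.

Lemma is_derive_var x : is_derive x 1 (fun y => y) 1.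
Proof. exact: is_derive_id. Qed.

Lemma is_derive_mul f g x a b : is_derive x 1 f a -> is_derive x 1 g b ->
  is_derive x 1 (fun y => f y * g y) (f x * b + g x * a).
Proof. by move=> df dg; exact: is_deriveM. Qed.

Lemma is_derive_add f g x a b : is_derive x 1 f a -> is_derive x 1 g b ->
  is_derive x 1 (fun y => f y + g y) (a + b).
Proof. by move=> df dg; exact: is_deriveD. Qed.

Lemma is_derive_sub f g x a b : is_derive x 1 f a -> is_derive x 1 g b ->
  is_derive x 1 (fun y => f y - g y) (a - b).
Proof. by move=> df dg; exact: is_deriveB. Qed.

Lemma is_derive_sqr f x a : is_derive x 1 f a ->
  is_derive x 1 (fun y => f y ^+ 2) (2 * f x * a).
Proof.
move=> df; have d : is_derive x 1 (f ^+ 2) _ := is_deriveX 2 df.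
by apply: is_derive_eq d _; rewrite expr1.
Qed.

Lemma is_derive_div f g x a b : is_derive x 1 f a -> is_derive x 1 g b ->
  g x != 0 ->
  is_derive x 1 (fun y => f y / g y) ((a * g x - f x * b) / g x ^+ 2).
Proof.
move=> df dg gx0; have dV := is_deriveV gx0 dg.
apply: is_derive_eq (is_derive_mul df dV) _.
rewrite /GRing.scale /=; by field.
Qed.

Lemma is_derive_affine x a b :
  is_derive x 1 (fun y => a * (y + b)) a.
Proof.
have d := is_derive_mul (is_derive_const a x)
  (is_derive_add (is_derive_var x) (is_derive_const b x)).
by apply: is_derive_eq d _; rewrite mulr0 !addr0 mulr1.
Qed.

Lemma is_derive_comp f g x a b : is_derive x 1 f a -> is_derive (f x) 1 g b ->
  is_derive x 1 (fun y => g (f y)) (b * a).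
Proof. by move=> df dg; exact: is_derive1_comp. Qed.

Lemma is_derive_continuous f x a : is_derive x 1 f a -> {for x, continuous f}.
Proof. by move=> [df _]; exact/differentiable_continuous/derivable1_diffP. Qed.

End scalar_derivatives.

(** * Lorentzians *)

(** The real part of (a - i b / p) / (y - (- q + i p)): a simple pole at
    height p above - q. *)
Definition lorentz {R : realType} (a b q p y : R) : R :=
  (a * (y + q) + b) / ((y + q) ^+ 2 + p ^+ 2).

Section lorentz.
Context {R : realType}.
Variables (q p : R).
Hypothesis p0 : 0 < p.
Implicit Types (a b x y : R).

Lemma lorentz_den_gt0 y : 0 < (y + q) ^+ 2 + p ^+ 2.
Proof. by rewrite ltr_wpDl ?sqr_ge0// exprn_gt0. Qed.

Lemma lorentz_den_neq0 y : (y + q) ^+ 2 + p ^+ 2 != 0.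
Proof. by rewrite gt_eqF// lorentz_den_gt0. Qed.

Lemma is_derive_lorentz_den y :
  is_derive y 1 (fun z => (z + q) ^+ 2 + p ^+ 2) (2 * (y + q)).
Proof.
have ds := is_derive_add (is_derive_var y) (is_derive_const q y).
have d := is_derive_add (is_derive_sqr ds) (is_derive_const (p ^+ 2) y).
by apply: is_derive_eq d _; rewrite !addr0 mulr1.
Qed.

Lemma is_derive_lorentz a b y :
  is_derive y 1 (lorentz a b q p)
    ((a * ((y + q) ^+ 2 + p ^+ 2) - (a * (y + q) + b) * (2 * (y + q))) /
     ((y + q) ^+ 2 + p ^+ 2) ^+ 2).
Proof.
have da := is_derive_add (is_derive_affine y a q) (is_derive_const b y).
have d := is_derive_div da (is_derive_lorentz_den y) (lorentz_den_neq0 y).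
by apply: is_derive_eq d _; rewrite addr0.
Qed.

Lemma is_derive_atan_affine y :
  is_derive y 1 (fun z => atan ((z + q) / p)) (p / ((y + q) ^+ 2 + p ^+ 2)).
Proof.
have ds := is_derive_affine y p^-1 q.
have d := is_derive_comp ds (is_derive1_atan (p^-1 * (y + q))).
rewrite (_ : (fun z => _) = fun z => atan (p^-1 * (z + q))); last first.
  by apply/funext => z; rewrite mulrC.
apply: is_derive_eq d _; have := lorentz_den_neq0 y.
have pN0 : p != 0 by rewrite gt_eqF.
by rewrite exprMn exprVn => D0; field; rewrite D0 pN0.
Qed.

Lemma cvg_lorentz_infty a b :
  lorentz a b q p y @[y --> +oo] --> 0 /\ lorentz a b q p y @[y --> -oo] --> 0.
Proof.
pose f z : R := (a * (1 + q * z) + b * z) * z / ((1 + q * z) ^+ 2 + (p * z) ^+ 2).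
have f0 : f 0 = 0 by rewrite /f mulr0 mul0r.
rewrite -f0; apply: cvg_infty_inv; last first.
  move=> y y0; rewrite /lorentz /f; have D0 := lorentz_den_neq0 y.
  have E0 : (1 + q * y^-1) ^+ 2 + (p * y^-1) ^+ 2 != 0.
    rewrite (_ : _ + _ = ((y + q) ^+ 2 + p ^+ 2) / y ^+ 2); last by field.
    by rewrite mulf_neq0// invr_neq0// expf_neq0.
  by field; rewrite y0 D0.
have d1 := is_derive_add (is_derive_const 1 0)
  (is_derive_mul (is_derive_const q 0) (is_derive_var 0)).
have dp := is_derive_mul (is_derive_const p 0) (is_derive_var 0).
have db := is_derive_mul (is_derive_const b 0) (is_derive_var 0).
have dn := is_derive_mul
  (is_derive_add (is_derive_mul (is_derive_const a 0) d1) db)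
  (is_derive_var 0).
have dd := is_derive_add (is_derive_sqr d1) (is_derive_sqr dp).
have dq D1 := is_derive_continuous (is_derive_div dn dd D1).
by apply: dq; rewrite !mulr0 addr0 expr1n expr0n addr0 oner_neq0.
Qed.

End lorentz.

(** * Hilbert transform of a Lorentzian and of its derivative *)

Section hilbert_lorentz.
Context {R : realType}.
Variables (q p : R).
Hypothesis p0 : 0 < p.
Implicit Types (a b x y : R).

(** The bound on [f] makes f y / (x - y) at most a constant, depending on e,
    times 1 / ((y + q)^2 + p^2), whose primitive is an arctangent. *)
Lemma hilbert_antiderivative (f G : R -> R) x A B l m :
  0 <= A -> 0 <= B ->
  continuous f ->
  (forall y, `|f y| * ((y + q) ^+ 2 + p ^+ 2) <= A * `|x - y| + B) ->
  (forall y, y != x -> is_derive y 1 G (f y / (x - y))) ->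
  G y @[y --> -oo] --> l -> G y @[y --> +oo] --> m ->
  G (x - e) - G (x + e) @[e --> 0^'+] --> 0 ->
  hilbert_ex f x /\ hilbert f x = pi^-1 * (m - l).
Proof.
move=> A0 B0 cf fAB dG Gl Gm Gx.
have pN0 : p != 0 by rewrite gt_eqF.
have [atl atm] := cvg_atan_affine q p0.
have trunc (e : R) : 0 < e ->
    lebesgue_measure.-integrable [set y | e < `|x - y|]
       (EFin \o (fun y => f y / (x - y))) /\
    hilbert_trunc f x e = m - l + (G (x - e) - G (x + e)).
  move=> e0; pose K := A + B / e.
  have xy_neq0 y : e <= `|x - y| -> x - y != 0.
    by move=> exy; rewrite -normr_gt0 (lt_le_trans e0).
  apply: (@dominated_FTC2_outer _ x e e0 _ _
    (fun y => K / ((y + q) ^+ 2 + p ^+ 2))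
    (fun y => K / p * atan ((y + q) / p))
    _ _ (K / p * - (pi / 2)) (K / p * (pi / 2))) => //.
  - move=> y exy; have xy0 := xy_neq0 _ exy.
    rewrite normrM normfV ler_pdivrMr ?normr_gt0//.
    rewrite mulrAC ler_pdivlMr ?lorentz_den_gt0// (le_trans (fAB y))//.
    rewrite /K mulrDl lerD2l mulrAC ler_pdivlMr// ler_wpM2l//.
  - move=> y exy; apply: continuousM; first exact: cf.
    apply: continuous_inv_at; first exact: xy_neq0.
    exact: (is_derive_continuous (is_derive_sub (is_derive_const x y)
      (is_derive_var y))).
  - move=> y _; have dD := is_derive_lorentz_den q p y.
    have := is_derive_div (is_derive_const K y) dD (lorentz_den_neq0 q p0 y).
    exact: is_derive_continuous.
  - move=> y /xy_neq0 xy0; apply: dG.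
    by rewrite eq_sym -subr_eq0.
  - move=> y _.
    have d := is_derive_mul (is_derive_const (K / p) y)
      (is_derive_atan_affine q p0 y).
    apply: is_derive_eq d _; have D0 := lorentz_den_neq0 q p0 y.
    by field; rewrite D0 pN0.
  - by apply: cvgM => //; exact: cvg_cst.
  - by apply: cvgM => //; exact: cvg_cst.
have cvgT : hilbert_trunc f x e @[e --> 0^'+] --> m - l.
  rewrite -[m - l]addr0.
  apply: (@cvg_trans _ ((m - l + (G (x - e) - G (x + e))) @[e --> 0^'+])).
    apply: near_eq_cvg; near=> e.
    have e0 : 0 < e by near: e; exact: nbhs_right_gt.
    by have [_ ->] := trunc e e0.
  by apply: cvgD => //; exact: cvg_cst.
split; first split.
- by move=> e /trunc[].
- by apply/cvg_ex; exists (m - l).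
- by rewrite /hilbert; congr (_ * _); exact: cvg_lim cvgT.
Unshelve. all: by end_near. Qed.

(** Partial fractions: with c = lorentz a b q p x,
      lorentz y / (x - y) = c / (x - y) + (c (y + q) + d) / ((y + q)^2 + p^2)
    where d = c (x + q) - a.  The two logarithms are merged into one, which
    makes the limits at infinity finite. *)
Definition lorentz_primitive a b x y : R :=
  lorentz a b q p x / 2 * ln (((y + q) ^+ 2 + p ^+ 2) / (x - y) ^+ 2) +
  (lorentz a b q p x * (x + q) - a) / p * atan ((y + q) / p).

Lemma is_derive_lorentz_primitive a b x y : y != x ->
  is_derive y 1 (lorentz_primitive a b x) (lorentz a b q p y / (x - y)).
Proof.
move=> yx; have xy0 : x - y != 0 by rewrite subr_eq0 eq_sym.
have pN0 : p != 0 by rewrite gt_eqF.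
have Dy := lorentz_den_neq0 q p0 y; have Dx := lorentz_den_neq0 q p0 x.
have dxy := is_derive_sqr (is_derive_sub (is_derive_const x y)
  (is_derive_var y)).
have dquot := is_derive_div (is_derive_lorentz_den q p y) dxy (expf_neq0 2 xy0).
have quot_gt0 : 0 < ((y + q) ^+ 2 + p ^+ 2) / (x - y) ^+ 2.
  by rewrite divr_gt0 ?lorentz_den_gt0// exprn_even_gt0.
have dln := is_derive_comp dquot (is_derive1_ln quot_gt0).
pose c := lorentz a b q p x.
(* b is eliminated in favour of the value c at x: the identity then holds
   with c as a free variable *)
have bE : b = c * ((x + q) ^+ 2 + p ^+ 2) - a * (x + q).
  by rewrite /c /lorentz divfK// addrC addKr.
have d := is_derive_add (is_derive_mul (is_derive_const (c / 2) y) dln)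
  (is_derive_mul (is_derive_const ((c * (x + q) - a) / p) y)
    (is_derive_atan_affine q p0 y)).
apply: is_derive_eq d _.
rewrite [in RHS]/lorentz [in RHS]bE; move: c {bE} => c.
by field; rewrite Dy xy0 pN0.
Qed.

Lemma cvg_lorentz_primitive_infty a b x :
  lorentz_primitive a b x y @[y --> -oo] -->
    - ((lorentz a b q p x * (x + q) - a) / p * (pi / 2)) /\
  lorentz_primitive a b x y @[y --> +oo] -->
    (lorentz a b q p x * (x + q) - a) / p * (pi / 2).
Proof.
have [atl atm] := cvg_atan_affine q p0.
pose f z : R := ln (((1 + q * z) ^+ 2 + (p * z) ^+ 2) / (x * z - 1) ^+ 2).
pose g y := ln (((y + q) ^+ 2 + p ^+ 2) / (x - y) ^+ 2).
have cf : {for 0, continuous f}.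
  have dq2 := is_derive_add
    (is_derive_sqr (is_derive_add (is_derive_const 1 0)
      (is_derive_mul (is_derive_const q 0) (is_derive_var 0))))
    (is_derive_sqr (is_derive_mul (is_derive_const p 0) (is_derive_var 0))).
  have dx2 := is_derive_sqr (is_derive_sub
    (is_derive_mul (is_derive_const x 0) (is_derive_var 0))
    (is_derive_const 1 0)).
  have dr D1 := is_derive_div dq2 dx2 D1.
  have dl D1 r0 := is_derive_continuous
    (is_derive_comp (dr D1) (@is_derive1_ln R _ r0)).
  apply: dl.
    by rewrite mulr0 add0r sqrrN expr1n oner_neq0.
  by rewrite !mulr0 addr0 expr0n addr0 add0r sqrrN !expr1n divr1 ltr01.
have gf y : y != 0 -> g y = f y^-1.
  move=> y0; rewrite /f; congr ln.
  (* at y = x both sides are ln 0, division by 0 giving 0 *)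
  have [->|xy] := eqVneq x y.
    by rewrite mulfV// !subrr expr0n !invr0 !mulr0.
  have xy0 : x - y != 0 by rewrite subr_eq0.
  by field; rewrite y0 mulN1r.
have [fy fNy] := cvg_infty_inv cf gf.
have f0 : f 0 = 0.
  rewrite /f !mulr0 addr0 expr0n addr0 add0r expr1n sqrrN expr1n divr1.
  exact: ln1.
rewrite f0 in fy fNy.
rewrite -mulrN -[_ * - _]add0r -[_ * (pi / 2)]add0r.
rewrite -(mulr0 (lorentz a b q p x / 2)).
by split; apply: cvgD; apply: cvgM => //; exact: cvg_cst.
Qed.

Lemma cvg_jump (f : R -> R) x : {for x, continuous f} ->
  f (x - e) - f (x + e) @[e --> 0^'+] --> 0.
Proof.
move=> cf; rewrite -[X in _ --> X](subrr (f x)).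
have c (s : R) : (x + s * e) @[e --> 0^'+] --> x.
  apply: cvg_at_right_filter.
  have d := is_derive_add (is_derive_const x 0)
    (is_derive_mul (is_derive_const s 0) (is_derive_var 0)).
  rewrite -[X in _ --> X]addr0 -[X in _ --> _ + X](mulr0 s).
  exact: (is_derive_continuous d).
have cN : (x - e) @[e --> 0^'+] --> x.
  by under eq_fun do rewrite -mulN1r; exact: c.
have c1 : (x + e) @[e --> 0^'+] --> x.
  by under eq_fun do rewrite -[X in x + X]mul1r; exact: c.
by apply: cvgB; [exact: cvg_comp cN cf|exact: cvg_comp c1 cf].
Qed.

(** The singular part depends on (x - y)^2 only, hence takes the same value at
    x - e and x + e; what remains is continuous at x. *)
Lemma lorentz_primitive_jump a b x :
  lorentz_primitive a b x (x - e) - lorentz_primitive a b x (x + e) @[e --> 0^'+] --> 0.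
Proof.
pose c := lorentz a b q p x.
pose K y := c / 2 * ln ((y + q) ^+ 2 + p ^+ 2) +
  (c * (x + q) - a) / p * atan ((y + q) / p).
have cK : {for x, continuous K}.
  have dln := is_derive_comp (is_derive_lorentz_den q p x)
    (is_derive1_ln (lorentz_den_gt0 q p0 x)).
  have d := is_derive_add (is_derive_mul (is_derive_const (c / 2) x) dln)
  (is_derive_mul (is_derive_const ((c * (x + q) - a) / p) x)
    (is_derive_atan_affine q p0 x)).
  exact: (is_derive_continuous d).
have KE (e : R) : 0 < e ->
    lorentz_primitive a b x (x - e) - lorentz_primitive a b x (x + e) =
    K (x - e) - K (x + e).
  move=> e0; rewrite /lorentz_primitive /K -/c.
  have e2 : e ^+ 2 \is Num.pos by rewrite posrE exprn_gt0.
  have Dpos y : (y + q) ^+ 2 + p ^+ 2 \is Num.pos.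
    by rewrite posrE lorentz_den_gt0.
  have -> : (x - (x - e)) ^+ 2 = e ^+ 2 by ring.
  have -> : (x - (x + e)) ^+ 2 = e ^+ 2 by ring.
  by rewrite !ln_div//; ring.
apply: (@cvg_trans _ ((K (x - e) - K (x + e)) @[e --> 0^'+])).
  apply: near_eq_cvg; near=> e.
  have e0 : 0 < e by near: e; exact: nbhs_right_gt.
  by rewrite KE.
exact: cvg_jump.
Unshelve. all: by end_near. Qed.

Lemma continuous_lorentz a b : continuous (lorentz a b q p).
Proof.
by move=> y; exact: is_derive_continuous (is_derive_lorentz q p0 a b y).
Qed.

(** The pole is in the upper half-plane, where the transform multiplies the
    residue by i: (a, b / p) becomes (b / p, - a). *)
Theorem hilbert_lorentz a b x :
  hilbert_ex (lorentz a b q p) x /\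
  hilbert (lorentz a b q p) x = lorentz (b / p) (- a * p) q p x.
Proof.
have pN0 : p != 0 by rewrite gt_eqF.
have Dx := lorentz_den_neq0 q p0 x.
have [potNy poty] := cvg_lorentz_primitive_infty a b x.
have bnd y : `|lorentz a b q p y| * ((y + q) ^+ 2 + p ^+ 2) <=
    `|a| * `|x - y| + `|a * (x + q) + b|.
  rewrite /lorentz normrM normfV (gtr0_norm (lorentz_den_gt0 q p0 y)).
  rewrite divfK ?lorentz_den_neq0//.
  rewrite (_ : a * (y + q) + b = a * (y - x) + (a * (x + q) + b)); last by ring.
  by rewrite (le_trans (ler_normD _ _))// normrM distrC.
have [ex ->] := hilbert_antiderivative (normr_ge0 _) (normr_ge0 _)
  (@continuous_lorentz a b) bnd (@is_derive_lorentz_primitive a b x) potNy poty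
  (lorentz_primitive_jump a b x).
split=> //; rewrite /lorentz.
have : (pi : R) != 0 by rewrite gt_eqF ?pi_gt0.
move: (pi : R) => k k0; by field; rewrite Dx pN0.
Qed.

Lemma derive1_lorentz a b y : derive1 (lorentz a b q p) y =
  (a * ((y + q) ^+ 2 + p ^+ 2) - (a * (y + q) + b) * (2 * (y + q))) /
     ((y + q) ^+ 2 + p ^+ 2) ^+ 2.
Proof.
by rewrite derive1E; have d := is_derive_lorentz q p0 a b y; rewrite derive_val.
Qed.

(** Write f = f x + (x - y) E with E the Lorentzian of coefficients c, d of
    the partial fractions.  Then f' y / (x - y) = E' y - E y / (x - y): the
    first term has primitive E, and the second is covered by
    [lorentz_primitive]. *)
Theorem hilbert_derive1_lorentz a b x :
  hilbert_ex (derive1 (lorentz a b q p)) x /\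
  hilbert (derive1 (lorentz a b q p)) x =
    derive1 (lorentz (b / p) (- a * p) q p) x.
Proof.
have pN0 : p != 0 by rewrite gt_eqF.
have Dx := lorentz_den_neq0 q p0 x.
pose c := lorentz a b q p x; pose d := c * (x + q) - a.
have bE : b = c * ((x + q) ^+ 2 + p ^+ 2) - a * (x + q).
  by rewrite /c /lorentz divfK// addrC addKr.
have [potNy poty] := cvg_lorentz_primitive_infty c d x.
have [lory lorNy] := cvg_lorentz_infty q p0 c d.
have cdf : continuous (derive1 (lorentz a b q p)).
  rewrite (funext (derive1_lorentz a b)) => y.
  have dD := is_derive_lorentz_den q p y.
  have ds := is_derive_affine y 1 q.
  have dn := is_derive_sub (is_derive_mul (is_derive_const a y) dD)
    (is_derive_mul (is_derive_add (is_derive_affine y a q) (is_derive_const b y))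
      (is_derive_affine y 2 q)).
  have := is_derive_div dn (is_derive_sqr dD).
  by move=> /(_ (expf_neq0 2 (lorentz_den_neq0 q p0 y))) /is_derive_continuous.
have jump : (lorentz c d q p (x - e) - lorentz_primitive c d x (x - e)) -
    (lorentz c d q p (x + e) - lorentz_primitive c d x (x + e)) @[e --> 0^'+] --> 0.
  rewrite (_ : (fun e => _) = (fun e =>
    (lorentz c d q p (x - e) - lorentz c d q p (x + e)) -
    (lorentz_primitive c d x (x - e) - lorentz_primitive c d x (x + e)))); last first.
    by apply/funext => e; ring.
  rewrite -[X in _ --> X](subr0 0); apply: cvgB (lorentz_primitive_jump _ _ _).
  by apply: cvg_jump; exact: continuous_lorentz.
have bnd y : `|derive1 (lorentz a b q p) y| * ((y + q) ^+ 2 + p ^+ 2) <=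
    0 * `|x - y| + (`|a| + `|b| / p).
  pose D z := (z + q) ^+ 2 + p ^+ 2; have D0 : 0 < D y := lorentz_den_gt0 q p0 y.
  rewrite derive1_lorentz normrM normfV (gtr0_norm (exprn_gt0 2 D0)).
  have cancel u : u / D y ^+ 2 * D y = u / D y by field; rewrite gt_eqF.
  rewrite -/(D y) cancel mul0r add0r ler_pdivrMr// [leRHS]mulrDl /D.
  rewrite (_ : _ - _ = a * (p ^+ 2 - (y + q) ^+ 2) - b * (2 * (y + q)));
    last by ring.
  rewrite (le_trans (ler_normB _ _))// !normrM lerD//.
    rewrite ler_wpM2l// ler_norml; move: (sqr_ge0 (y + q)) (sqr_ge0 p); lra.
  rewrite -mulrA ler_wpM2l// [leRHS]mulrC ler_pdivlMr//.
  rewrite (ger0_norm (ler0n R 2)) -(real_normK (num_real (y + q))).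
  have := sqr_ge0 (`|y + q| - p); rewrite sqrrB -mulr_natl; lra.
have dE y : y != x -> is_derive y 1
    (fun y => lorentz c d q p y - lorentz_primitive c d x y)
    (derive1 (lorentz a b q p) y / (x - y)).
  move=> yx; have xy0 : x - y != 0 by rewrite subr_eq0 eq_sym.
  have dd := is_derive_sub (is_derive_lorentz q p0 c d y)
    (is_derive_lorentz_primitive c d yx).
  apply: is_derive_eq dd _; rewrite derive1_lorentz /lorentz bE /d.
  have Dy := lorentz_den_neq0 q p0 y.
  move: c {potNy poty lory lorNy jump d bE} => c.
  by field; rewrite Dy xy0.
have [||ex ->] := hilbert_antiderivative _ _ cdf bnd dE
  (cvgB lorNy potNy) (cvgB lory poty) jump => //.
  by rewrite addr_ge0 ?divr_ge0// ltW.
split=> //; rewrite derive1_lorentz [lorentz c d q p x]/lorentz bE /d.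
have : (pi : R) != 0 by rewrite gt_eqF ?pi_gt0.
move: c (pi : R) {potNy poty lory lorNy jump dE bnd d bE} => c k k0.
by field; rewrite Dx pN0.
Qed.

End hilbert_lorentz.

(** * Norms *)

(** If the essential supremum were below the attained value M, the values of
    [f] would exceed it on a whole ball, which has positive measure. *)
Lemma Linfty_norm_max (R : realType) (f : R -> R) (M y0 : R) :
  continuous f -> (forall y, `|f y| <= M) -> `|f y0| = M ->
  Linfty_norm f = M%:E.
Proof.
move=> cf fM f0; rewrite /Linfty_norm unlock /=.
have muT : (0 < @lebesgue_measure R [set: R])%E.
  have := @lebesgue_measure_itv R `]-oo, +oo[; rewrite set_itvE => -> /=.
  by rewrite lt0y.
rewrite muT; apply/eqP; rewrite eq_le; apply/andP; split.
  by apply: ess_sup_ler => y /=; rewrite lee_fin.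
apply: le_ereal_inf_tmp => r /= fr; rewrite leNgt; apply/negP => rM.
have cn : continuous (fun y => `|f y|).
  by move=> y; apply: continuous_comp; [exact: cf|exact: norm_continuous].
have mf : measurable_fun [set: R] (abse \o (EFin \o f)).
  by apply/measurable_EFinP; exact: continuous_measurable_fun.
have /ae_le_measureP := fr; move=> /(_ mf) mu0.
have : \forall y \near y0, (r < `|f y|%:E)%E.
  case: r rM {fr mu0} => [r| |] //.
  - rewrite lte_fin -f0 => rM.
    exact: cvgr_gt (cn y0) _ rM.
  - by move=> _; exists 1 => //= y _; exact: ltNyr.
move=> [e /= e0 be].
have := @lebesgue_measure_ball R y0 e (ltW e0).
suff -> : @lebesgue_measure R (ball y0 e) = 0%E.
  by move=> [/esym/eqP]; rewrite mulrn_eq0/= gt_eqF.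
apply/eqP; rewrite eq_le measure_ge0 andbT -mu0; apply: le_measure.
- by rewrite inE; exact: measurable_ball.
- by rewrite inE -[X in measurable X]setTI; apply: mf => //; exact: emeasurable_itv.
- by move=> y /be /=; rewrite in_itv/= andbT.
Qed.

Section lorentz_norms.
Context {R : realType}.
Variables (q p : R).
Hypothesis p0 : 0 < p.
Implicit Types (a b x y : R).

Let pN0 : p != 0. Proof. by rewrite gt_eqF. Qed.

(** Put k = b / p, N = sqrt (a^2 + k^2) and K = N + |k|, so that
    K (K - 2 |k|) = a^2.  The bound K (z^2 + p^2) >= 2 p (a z + k p) becomes,
    after multiplication by K, the sum of squares
    (K z - a p)^2 + 2 K (|k| - k) p^2 >= 0, and equality holds at
    z = a p / K when k >= 0; the other sign is symmetric.  When K = 0, both a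
    and k vanish. *)
Lemma lorentz_Linfty a b : Linfty_norm (lorentz a b q p) =
  ((Num.sqrt (a ^+ 2 + (b / p) ^+ 2) + `|b / p|) / (2 * p))%:E.
Proof.
set N : R := Num.sqrt _; pose k : R := b / p; pose K : R := N + `|k|.
have N2 : N ^+ 2 = a ^+ 2 + k ^+ 2 by rewrite sqr_sqrtr// addr_ge0// sqr_ge0.
have bE : b = k * p by rewrite /k divfK.
have N0 : 0 <= N := sqrtr_ge0 _.
have K0 : 0 <= K by rewrite addr_ge0.
have KK : K * (K - 2 * `|k|) = a ^+ 2.
  rewrite /K; transitivity (N ^+ 2 - `|k| ^+ 2); first by ring.
  by rewrite N2 real_normK ?num_real//; ring.
have a0 : K = 0 -> a = 0.
  by move=> K00; apply/eqP; rewrite -sqrf_eq0 -KK K00 mul0r.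
have k0 : K = 0 -> k = 0.
  move=> /eqP; rewrite paddr_eq0// => /andP[_ /eqP/normr0_eq0]; exact.
pose s := (if 0 <= k then a * p / K else - (a * p / K)).
apply: (@Linfty_norm_max _ _ _ (s - q)).
- exact: continuous_lorentz.
- move=> y; rewrite /lorentz normrM normfV (gtr0_norm (lorentz_den_gt0 q p0 y)).
  rewrite ler_pdivrMr ?lorentz_den_gt0// mulrAC ler_pdivlMr ?mulr_gt0//.
  rewrite -/k -/K bE.
  have [K00|KN0] := eqVneq K 0.
    by rewrite a0// k0// !mul0r addr0 normr0 K00 !mul0r.
  have Kgt0 : 0 < K by rewrite lt_neqAle eq_sym KN0.
  rewrite -(@ler_pM2l _ K)//.
  set z := y + q.
  have main a' c : a' ^+ 2 = a ^+ 2 -> c <= `|k| ->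
     K * ((a' * z + c * p) * (2 * p)) <= K * (K * (z ^+ 2 + p ^+ 2)).
    move=> aE ck; rewrite -subr_ge0.
    rewrite (_ : _ - _ = (K * z - a' * p) ^+ 2 + 2 * K * (`|k| - c) * p ^+ 2).
      have kc : 0 <= `|k| - c by rewrite subr_ge0.
      by rewrite addr_ge0 ?sqr_ge0// !mulr_ge0// ltW.
    have -> : K * (K * (z ^+ 2 + p ^+ 2)) =
      (K * z) ^+ 2 + (a' ^+ 2 + 2 * `|k| * K) * p ^+ 2 by rewrite aE -KK; ring.
    by ring.
  case: (ger0P (a * z + k * p)) => _; first by apply: main => //; exact: ler_norm.
  rewrite opprD -(mulNr a) -(mulNr k); apply: main; first exact: sqrrN.
  by rewrite -[`|k|]normrN ler_norm.
- rewrite /lorentz subrK -/k -/K.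
  have [K00|KN0] := eqVneq K 0.
    by rewrite bE a0// k0// !mul0r addr0 mul0r normr0 K00 mul0r.
  pose t : R := if 0 <= k then 1 else -1.
  have t1 : `|t| = 1 by rewrite /t; case: ifP; rewrite ?normrN normr1.
  have tk : t * k = `|k|.
    by rewrite /t; case: (ger0P k); rewrite ?mul1r// mulN1r.
  have tt : t ^+ 2 = 1 by rewrite -real_normK ?num_real// t1 expr1n.
  have sE : s = t * (a * p / K).
    by rewrite /s /t; case: ifP; rewrite ?mul1r// mulN1r.
  have kE : k = t * `|k| by rewrite -tk mulrA -expr2 tt mul1r.
  suff -> : (a * s + b) / (s ^+ 2 + p ^+ 2) = t * (K / (2 * p)).
    by rewrite normrM t1 mul1r ger0_norm// divr_ge0// mulr_ge0// ltW.
  have D0 := lorentz_den_neq0 0 p0 s; rewrite addr0 in D0.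
  clearbody K s t; apply: (mulIf D0); rewrite divfK// bE kE.
  apply: (@mulIf _ (2 * K)); first by rewrite mulf_neq0.
  have -> : s ^+ 2 + p ^+ 2 = (a ^+ 2 / K ^+ 2 + 1) * p ^+ 2.
    by rewrite sE !exprMn exprVn tt mul1r mulrDl mul1r mulrAC.
  have -> : (a * s + t * `|k| * p) * (2 * K) = 2 * t * p * (a ^+ 2 + `|k| * K).
    by rewrite sE; field.
  rewrite -KK; move: (`|k|) => n.
  by field; rewrite pN0 KN0.
Qed.

Lemma integral_lorentz_sqr a b :
  (\int[lebesgue_measure]_y ((lorentz a b q p y) ^+ 2)%:E =
   (pi * (a ^+ 2 + (b / p) ^+ 2) / (2 * p))%:E)%E.
Proof.
(* the coefficients of the primitive come from matching those of the
   numerator (a s + b)^2, with s = y + q *)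
pose c := (a ^+ 2 + (b / p) ^+ 2) / (2 * p).
pose F y := lorentz (((b / p) ^+ 2 - a ^+ 2) / 2) (- (a * b)) q p y +
  c * atan ((y + q) / p).
have dF y : is_derive y 1 F (lorentz a b q p y ^+ 2).
  have d := is_derive_add (is_derive_lorentz q p0 (((b / p) ^+ 2 - a ^+ 2) / 2) (- (a * b)) y)
    (is_derive_mul (is_derive_const c y) (is_derive_atan_affine q p0 y)).
  apply: is_derive_eq d _; rewrite /lorentz /c.
  have Dy := lorentz_den_neq0 q p0 y.
  by field; rewrite Dy pN0.
have c2 : continuous (fun y => lorentz a b q p y ^+ 2).
  move=> y.
  exact: is_derive_continuous (is_derive_sqr (is_derive_lorentz q p0 a b y)).
have [lory lorNy] := cvg_lorentz_infty q p0 (((b / p) ^+ 2 - a ^+ 2) / 2) (- (a * b)).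
have [aty atNy] := cvg_atan_affine q p0.
have Fy : F y @[y --> +oo] --> c * (pi / 2).
  by rewrite -[c * _]add0r; apply: cvgD => //; apply: cvgM => //; exact: cvg_cst.
have FNy : F y @[y --> -oo] --> c * - (pi / 2).
  by rewrite -[c * _]add0r; apply: cvgD => //; apply: cvgM => //; exact: cvg_cst.
have mf : measurable_fun [set: R] (fun y => ((lorentz a b q p y) ^+ 2)%:E).
  by apply/measurable_EFinP; exact: continuous_measurable_fun.
have TE : [set: R] = `]-oo, 0]%classic `|` `]0, +oo[%classic.
  apply/seteqP; split=> y //= _; rewrite !in_itv/= andbT.
  by have [?|?] := leP y 0; [left|right].
rewrite TE ge0_integral_setU //=; last 3 first.
- by rewrite -TE.
- by move=> y _; rewrite lee_fin sqr_ge0.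
- apply/disj_setPS => y [] /=; rewrite !in_itv/= andbT => yl yr.
  by move: (lt_le_trans yr yl); rewrite ltxx.
rewrite integral_itv_obnd_cbnd; last exact: measurable_funS mf.
rewrite (ge0_FTC2y _ _ _ Fy); last 2 first.
- by move=> y _; rewrite sqr_ge0.
- by move=> y _; exact: c2.
rewrite (ge0_FTC2Ny _ _ _ FNy); last 2 first.
- by move=> y _; rewrite sqr_ge0.
- by move=> y _; exact: c2.
rewrite -EFinD; congr EFin; rewrite /c; move: (F 0) (pi : R) => *.
by field.
Qed.

Lemma lorentz_L2 a b : L2_norm (lorentz a b q p) =
  (Num.sqrt (pi * (a ^+ 2 + (b / p) ^+ 2) / (2 * p)))%:E.
Proof.
rewrite /L2_norm unlock /=.
under eq_integral do rewrite powR_mulrn// real_normK ?num_real//.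
rewrite integral_lorentz_sqr poweR_EFin powR12_sqrt//.
rewrite divr_ge0// ?mulr_ge0// ?pi_ge0 ?addr_ge0 ?sqr_ge0// ltW//.
Qed.
End lorentz_norms.

(** * The pole solution *)

Section omega.
Context {R : realType}.
Variables (nu : R) (w0 v0 : R[i]).
Let a := complex.Re w0.
Let b := complex.Im w0.
Let v := vc nu w0 v0.
Let w := omega nu w0 v0.

Lemma Re_vc t : complex.Re (v t) = (a + nu) * t + complex.Re v0.
Proof.
by rewrite /v /vc /a; case: w0 v0 => [? ?] [? ?] /=; rewrite mulr0 subr0.
Qed.

Lemma Im_vc t : complex.Im (v t) = b * t + complex.Im v0.
Proof.
by rewrite /v /vc /b; case: w0 v0 => [? ?] [? ?] /=; rewrite mulr0 add0r addr0.
Qed.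

(** The identity also holds at a pole, both sides being 0 there since the
    inverse of 0 is 0. *)
Lemma omegaC_lorentz x t : omegaC nu w0 v0 x t =
  (lorentz (2 * a) (- (2 * b * complex.Re (v t)))
    (complex.Im (v t)) (complex.Re (v t)) x)%:C.
Proof.
rewrite /omegaC -/v /a /b; case: (v t) w0 => [p q] [c d].
have e1 : x - (0 * p - 1 * q) = x + q by ring.
have e2 : 0 - (0 * q + 1 * p) = - p by ring.
have e3 : x + (0 * p - 1 * - q) = x + q by ring.
have e4 : 0 + (0 * - q + 1 * p) = p by ring.
apply/eqP; rewrite eq_complex /= e1 e2 e3 e4 sqrrN /lorentz.
move: ((x + q) ^+ 2 + p ^+ 2)^-1 => d'.
by apply/andP; split; apply/eqP; ring.
Qed.

Lemma omega_lorentz x t : w x t =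
  lorentz (2 * a) (- (2 * b * complex.Re (v t)))
    (complex.Im (v t)) (complex.Re (v t)) x.
Proof. by rewrite /w /omega omegaC_lorentz. Qed.

Lemma omegaC_real x t : omegaC nu w0 v0 x t = (w x t)%:C.
Proof. by rewrite omega_lorentz omegaC_lorentz. Qed.

Lemma omega_lorentzE t : (fun x => w x t) =
  lorentz (2 * a) (- (2 * b * complex.Re (v t)))
    (complex.Im (v t)) (complex.Re (v t)).
Proof. by apply/funext => x; exact: omega_lorentz. Qed.

Lemma is_derive_omega_time x t : 0 < complex.Re (v t) ->
  let p := complex.Re (v t) in let s := x + complex.Im (v t) in
  is_derive t 1 (w x)
    ((2 * (a * b - b * (a + nu)) * (s ^+ 2 + p ^+ 2) -
      2 * (a * s - b * p) * (2 * s * b + 2 * p * (a + nu))) /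
     (s ^+ 2 + p ^+ 2) ^+ 2).
Proof.
move=> p0 p s.
have wE : w x = (fun r =>
    (2 * a * (x + (b * r + complex.Im v0)) -
     2 * b * ((a + nu) * r + complex.Re v0)) /
    ((x + (b * r + complex.Im v0)) ^+ 2 + ((a + nu) * r + complex.Re v0) ^+ 2)).
  by apply/funext => r; rewrite omega_lorentz /lorentz Re_vc Im_vc.
have dline k c : is_derive t 1 (fun r => k * r + c) k.
  have d := is_derive_add (is_derive_mul (is_derive_const k t) (is_derive_var t))
    (is_derive_const c t).
  by apply: is_derive_eq d _; rewrite mulr0 !addr0 mulr1.
have ds := is_derive_add (is_derive_const x t) (dline b (complex.Im v0)).
have dp := dline (a + nu) (complex.Re v0).
have dn := is_derive_sub (is_derive_mul (is_derive_const (2 * a) t) ds)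
  (is_derive_mul (is_derive_const (2 * b) t) dp).
have dd := is_derive_add (is_derive_sqr ds) (is_derive_sqr dp).
have D0 := lorentz_den_neq0 (complex.Im (v t)) p0 x.
rewrite Re_vc Im_vc in D0.
rewrite wE; have d := is_derive_div dn dd D0; apply: is_derive_eq d _.
rewrite /p /s Re_vc Im_vc; congr (_ / _); ring.
Qed.

Lemma omega_is_solution (T : set R) :
  (forall t, T t -> 0 < complex.Re (v t)) -> is_solution nu T w.
Proof.
move=> Tp t x /Tp p0; have dt := is_derive_omega_time x p0.
have [exH HE] := hilbert_lorentz (complex.Im (v t)) p0 (2 * a)
  (- (2 * b * complex.Re (v t))) x.
have [exL LE] := hilbert_derive1_lorentz (complex.Im (v t)) p0 (2 * a)
  (- (2 * b * complex.Re (v t))) x.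
have dx := is_derive_lorentz (complex.Im (v t)) p0 (2 * a)
  (- (2 * b * complex.Re (v t))) x.
rewrite /Lambda (omega_lorentzE t); split.
- by case: dt.
- by case: dx.
- exact: exH.
- exact: exL.
- rewrite derive1E (@derive_val _ _ _ _ _ _ _ dt) HE LE derive1_lorentz// omega_lorentz /lorentz.
  have D0 := lorentz_den_neq0 (complex.Im (v t)) p0 x.
  have pN0 : complex.Re (v t) != 0 by rewrite gt_eqF.
  move: (complex.Re (v t)) (complex.Im (v t)) D0 pN0 => p q D0 pN0.
  by field; rewrite D0 pN0.
Qed.

Lemma normc_sqr : Normc.normc w0 ^+ 2 = a ^+ 2 + b ^+ 2.
Proof.
by rewrite /a /b; case: w0 => c d /=; rewrite sqr_sqrtr// addr_ge0// sqr_ge0.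
Qed.

Lemma normcw_ge0 : 0 <= Normc.normc w0.
Proof. by case: w0 => c d; exact: sqrtr_ge0. Qed.

Lemma omega_Linfty t : 0 < complex.Re (v t) -> Linfty_norm (fun x => w x t) =
  ((Normc.normc w0 + `|b|) / complex.Re (v t))%:E.
Proof.
move=> p0; have pN0 : complex.Re (v t) != 0 by rewrite gt_eqF.
rewrite (omega_lorentzE t) lorentz_Linfty//; congr EFin.
have -> : - (2 * b * complex.Re (v t)) / complex.Re (v t) = - (2 * b).
  by rewrite mulNr mulfK.
have -> : (2 * a) ^+ 2 + (- (2 * b)) ^+ 2 = (2 * Normc.normc w0) ^+ 2.
  by rewrite sqrrN !exprMn -mulrDr normc_sqr.
rewrite sqrtr_sqr ger0_norm ?mulr_ge0 ?normcw_ge0// normrN normrM.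
rewrite (ger0_norm (ler0n R 2)); move: (`|b|) => k.
by field.
Qed.

Lemma omega_L2 t : 0 < complex.Re (v t) -> L2_norm (fun x => w x t) =
  (Num.sqrt (2 * pi) * (Normc.normc w0 / Num.sqrt (complex.Re (v t))))%:E.
Proof.
move=> p0; have pN0 : complex.Re (v t) != 0 by rewrite gt_eqF.
rewrite (omega_lorentzE t) lorentz_L2//; congr EFin.
have -> : - (2 * b * complex.Re (v t)) / complex.Re (v t) = - (2 * b).
  by rewrite mulNr mulfK.
have -> : (2 * a) ^+ 2 + (- (2 * b)) ^+ 2 = (2 * Normc.normc w0) ^+ 2.
  by rewrite sqrrN !exprMn -mulrDr normc_sqr.
have -> : pi * (2 * Normc.normc w0) ^+ 2 / (2 * complex.Re (v t)) =
    (2 * pi) * (Normc.normc w0 ^+ 2 / complex.Re (v t)).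
  by move: (pi : R) (Normc.normc w0 : R) => k n; field.
rewrite sqrtrM ?mulr_ge0 ?pi_ge0//; congr (_ * _); rewrite sqrtrM ?sqr_ge0//.
by rewrite sqrtr_sqr ger0_norm ?normcw_ge0// sqrtrV// ltW.
Qed.

Let tc := - (complex.Re v0 / (a + nu)).

Section blowup.
Hypothesis hnu : 0 < nu.
Hypothesis hv : 0 < complex.Re v0.
Hypothesis ha : a < - nu.

Let an0 : a + nu < 0. Proof. by rewrite -ltrBrDr sub0r. Qed.

Lemma Re_vc_tc t : complex.Re (v t) = (a + nu) * (t - tc).
Proof.
have an : a + nu != 0 by rewrite lt_eqF.
by rewrite Re_vc /tc; field.
Qed.

Lemma tc_gt0 : 0 < tc.
Proof. by rewrite /tc -mulrN -invrN divr_gt0// oppr_gt0. Qed.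

Lemma Re_vc_gt0 t : (0 < complex.Re (v t)) = (t < tc).
Proof. by rewrite Re_vc_tc nmulr_rgt0// subr_lt0. Qed.

(** The sup norm is C / Re v with C > 0 constant in time, and
    Re v = (Re w0 + nu) (t - tc) tends to 0 from above. *)
Lemma omega_singular : singular_at nu w tc.
Proof.
split; first exact: tc_gt0.
  by apply: omega_is_solution => t /= /andP[_]; rewrite Re_vc_gt0.
have C0 : 0 < Normc.normc w0 + `|b|.
  rewrite ltr_pwDl// lt0r normcw_ge0 andbT -sqrf_eq0 normc_sqr gt_eqF//.
  by rewrite ltr_pwDl ?sqr_ge0// exprn_even_gt0//= lt_eqF// (lt_trans ha)// oppr_lt0.
apply: (@cvg_trans _
  (((Normc.normc w0 + `|b|) * (complex.Re (v t))^-1)%:E @[t --> tc^'-])).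
  apply: near_eq_cvg; near=> t; rewrite omega_Linfty// Re_vc_gt0.
  by near: t; exact: nbhs_left_lt.
apply/cvgeryP/(gt0_cvgMry C0)/cvgrVy.
  near=> t; rewrite Re_vc_gt0.
  by near: t; exact: nbhs_left_lt.
rewrite (_ : (fun t => complex.Re (v t)) = (fun t => (a + nu) * (t - tc)));
  last by apply/funext => t; exact: Re_vc_tc.
apply: cvg_at_left_filter.
have <- : (a + nu) * (tc - tc) = 0 by rewrite subrr mulr0.
exact: is_derive_continuous (is_derive_affine tc (a + nu) (- tc)).
Unshelve. all: by end_near. Qed.

End blowup.
End omega.

Lemma conj_vc (R : realType) (nu : R) (w0 v0 : R[i]) (t : R) :
  (vc nu w0 v0 t)^*%C = vc nu w0^*%C v0^*%C t.
Proof.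
case: w0 v0 => [a b] [p q]; apply/eqP; rewrite eq_complex /=.
by apply/andP; split; apply/eqP; ring.
Qed.

(** Since i v(tc) = xc, the rate of the pole is i (w0 + nu) = - xip, so that
    i nu + xip = - i w0 and x - i v(t) = (tc - t) (xi - xip); the conjugate
    pole is handled in the same way. *)
Lemma omegaC_self_similar (R : realType) (nu : R) (w0 v0 : R[i]) (tc xc x t : R) :
  tc != 0 -> tc - t != 0 -> 'i%C * vc nu w0 v0 tc = xc%:C ->
  - 'i%C * (vc nu w0 v0 tc)^*%C = xc%:C ->
  let xip := ('i%C * v0 - xc%:C) / tc%:C in
  let xim := (- 'i%C * v0^*%C - xc%:C) / tc%:C in
  let xi := ((x - xc) / (tc - t))%:C in
  omegaC nu w0 v0 x t = 'i%C / (tc - t)%:C *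
    ((xip + 'i%C * nu%:C) / (xi - xip) - (xim - 'i%C * nu%:C) / (xi - xim)).
Proof.
move=> tc0 u0 pole poleJ xip xim xi.
have ii : 'i%C * 'i%C = -1 :> R[i] by rewrite -expr2 sqr_i.
have CB (r s : R) : (r - s)%:C = r%:C - s%:C by exact: rmorphB.
have T0 : tc%:C != 0 :> R[i] by rewrite fmorph_eq0.
have xiE : (tc - t)%:C * xi = x%:C - xc%:C.
  by rewrite -CB -rmorphM mulrC divfK.
have xipE : xip = - ('i%C * (w0 + nu%:C)).
  apply: (mulIf T0); rewrite divfK// -pole /vc.
  by ring.
have ximE : xim = 'i%C * (w0^*%C + nu%:C).
  apply: (mulIf T0); rewrite divfK// -poleJ conj_vc /vc.
  by ring.
have dE : x%:C - 'i%C * vc nu w0 v0 t = (tc - t)%:C * (xi - xip).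
  rewrite mulrBr xiE xipE -pole /vc CB.
  by ring.
have dEJ : x%:C + 'i%C * (vc nu w0 v0 t)^*%C = (tc - t)%:C * (xi - xim).
  rewrite mulrBr xiE ximE -poleJ !conj_vc /vc CB.
  by ring.
rewrite /omegaC dE dEJ !invfM xipE ximE.
rewrite (_ : - _ + 'i%C * nu%:C = - ('i%C * w0)); last by ring.
rewrite (_ : _ - 'i%C * nu%:C = 'i%C * w0^*%C); last by ring.
set A := (xi - _)^-1; set B := (xi - _)^-1; set U := (_%:C)^-1.
transitivity (- ('i%C * 'i%C) * (w0 * (U * A) + w0^*%C * (U * B)));
  last by ring.
by rewrite ii opprK mul1r.
Qed.

(** * The theorem *)

Theorem mainTheorem4 (R : realType) (nu : R) (hnu : 0 < nu) (w0 : R[i]) :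
  (forall v0 : R[i], 0 < complex.Re v0 ->
    let v := vc nu w0 v0 in
    let w := omega nu w0 v0 in
    [/\ (* exact real-valued solution as long as Re v_c(t) > 0 *)
        (forall x t : R, 0 < complex.Re (v t) -> omegaC nu w0 v0 x t = (w x t)%:C) /\
        is_solution nu [set t | 0 < complex.Re (v t)] w,
        (* norms *)
        (forall t : R, 0 < complex.Re (v t) ->
          Linfty_norm (fun x => w x t)
            = ((Normc.normc w0 + `|complex.Im w0|) / complex.Re (v t))%:E /\
          L2_norm (fun x => w x t)
            = (Num.sqrt (2 * pi) * (Normc.normc w0 / Num.sqrt (complex.Re (v t))))%:E),
        (* (a) *)
        (w0 = - nu%:C -> forall x t : R, w x t = w x 0),
        (* (b) *)
        (- nu < complex.Re w0 ->
          (forall t : R, 0 <= t -> 0 < complex.Re (v t)) /\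
          is_solution nu [set t | 0 <= t] w) &
        (* (c) *)
        (complex.Re w0 < - nu ->
          let tc := - (complex.Re v0 / (complex.Re w0 + nu)) in
          let xc := complex.Im w0 * complex.Re v0 / (complex.Re w0 + nu) - complex.Im v0 in
          let xip := ('i%C * v0 - xc%:C) / tc%:C in
          let xim := (- 'i%C * v0^*%C - xc%:C) / tc%:C in
          [/\ (forall t : R, 0 < complex.Re (v t) <-> t < tc),
              singular_at nu w tc,
              'i%C * v tc = xc%:C /\ - 'i%C * (v tc)^*%C = xc%:C &
              forall x t : R, 0 <= t < tc ->
                let xi := ((x - xc) / (tc - t))%:C in
                omegaC nu w0 v0 x t =
                  'i%C / (tc - t)%:C *
                  ((xip + 'i%C * nu%:C) / (xi - xip)
                   - (xim - 'i%C * nu%:C) / (xi - xim))])]) /\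
  (* singularities from arbitrarily small data *)
  (complex.Re w0 < - nu ->
    forall eps : R, 0 < eps ->
      exists2 M : R, 0 < M & forall v0 : R[i], M <= complex.Re v0 ->
        let w := omega nu w0 v0 in
        [/\ (Linfty_norm (fun x => w x 0%R) < eps%:E)%E,
            (L2_norm (fun x => w x 0%R) < eps%:E)%E &
            exists tc : R, singular_at nu w tc]).
Proof.
split=> [v0 hv v w|ha eps eps0]; last first.
  have n2 := normcw_ge0 w0.
  pose C := Normc.normc w0 + `|complex.Im w0|.
  have C0 : 0 <= C by rewrite addr_ge0.
  pose S := 2 * pi * Normc.normc w0 ^+ 2.
  have S0 : 0 <= S by rewrite !mulr_ge0 ?pi_ge0 ?exprn_ge0.
  (* the two fractions control the two norms; 1 keeps the bound positive *)
  exists (1 + C / eps + S / eps ^+ 2).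
    by rewrite !ltr_pwDl ?divr_ge0 ?exprn_ge0// ltW.
  move=> v0 hM w.
  have e1 : 0 <= C / eps by rewrite divr_ge0// ltW.
  have e2 : 0 <= S / eps ^+ 2 by rewrite divr_ge0// exprn_ge0// ltW.
  have hv : 0 < complex.Re v0 by lra.
  have v00 : vc nu w0 v0 0 = v0 by rewrite /vc rmorph0 mulr0 add0r.
  have hv0 : 0 < complex.Re (vc nu w0 v0 0) by rewrite v00.
  split.
  - rewrite omega_Linfty// v00 lte_fin -/C ltr_pdivrMr// mulrC -ltr_pdivrMr//; lra.
  - rewrite omega_L2// v00 lte_fin.
    rewrite -[X in X / Num.sqrt _](ger0_norm n2) -sqrtr_sqr -sqrtrV ?ltW//.
    rewrite -!sqrtrM ?mulr_ge0 ?pi_ge0 ?sqr_ge0//.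
    rewrite -(ger0_norm (ltW eps0)) -sqrtr_sqr ltr_sqrt ?exprn_gt0//.
    rewrite mulrA -/S ltr_pdivrMr// mulrC -ltr_pdivrMr ?exprn_gt0//; lra.
  - by exists (- (complex.Re v0 / (complex.Re w0 + nu))); exact: omega_singular.
split.
- split; first by move=> x t _; exact: omegaC_real.
  exact: omega_is_solution.
- by move=> t ht; split; [exact: omega_Linfty|exact: omega_L2].
- move=> wE x t; rewrite /w /omega /omegaC /vc wE.
  by rewrite addNr !mul0r.
- move=> ha.
  have pos t : 0 <= t -> 0 < complex.Re (v t).
    by move=> t0; rewrite Re_vc ltr_wpDl// mulr_ge0//; lra.
  by split; [exact: pos|exact: omega_is_solution].
- move=> ha tc xc xip xim.
  have an : complex.Re w0 + nu != 0 by rewrite lt_eqF//; lra.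
  have tc0 : tc != 0 by rewrite gt_eqF// tc_gt0.
  have [pole poleJ] : 'i%C * v tc = xc%:C /\ - 'i%C * (v tc)^*%C = xc%:C.
    have Rv : complex.Re (v tc) = 0 by rewrite Re_vc /tc; field.
    have Iv : complex.Im (v tc) = - xc by rewrite Im_vc /tc /xc; field.
    move: Rv Iv; case: (v tc) => p q /= -> ->.
    by split; apply/eqP; rewrite eq_complex /=; apply/andP; split; apply/eqP; ring.
  split.
  + by move=> t; rewrite Re_vc_gt0.
  + exact: omega_singular.
  + by split.
  + move=> x t /andP[_ ttc] xi; apply: omegaC_self_similar => //.
    by rewrite subr_eq0 gt_eqF.
Qed.
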